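(* For $M,N,n\in\mathbb{Z}_+$ with $M\le N$ and $n\le N$, let $X_{M,N,n}$ be a hypergeometric random variable with parameters $M,N,n$, that is, $$\mathbf{P}(X_{M,N,n}=k)=\frac{\binom{M}{k}\binom{N-M}{n-k}}{\binom{N}{n}},\qquad k=0,1,\ldots,\min(M,n).$$ Then for every real $y>0$, $$\inf\,\mathbf{P}\left(|X_{M,N,n}-\mathbf{E}[X_{M,N,n}]|\ge y\sqrt{\mathrm{Var}(X_{M,N,n})}\right)=0,$$ where the infimum is taken over all $M,N,n\in\mathbb{Z}_+$ satisfying $M\le N$ and $n\le N$.
   Context: $\mathbf{P}$, $\mathbf{E}$ and $\mathrm{Var}$ denote probability, expectation and variance. $\mathbb{Z}_+$ denotes the set of positive integers. Binomial coefficients $\binom{a}{b}$ with integers $a\ge 0$ and $b>a$ are taken to be $0$. *)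

(* Defs.v *)
From HB Require Import structures.
From mathcomp Require Import all_boot all_order all_algebra.
From mathcomp Require Import all_classical all_reals all_analysis.
Set Implicit Arguments.
Unset Strict Implicit.
Unset Printing Implicit Defensive.
Import Order.TTheory GRing.Theory Num.Theory.
Local Open Scope classical_set_scope.
Local Open Scope ring_scope.

Definition hypergeometric_pmf (R : realType) (M N n k : nat) : R :=
  ('C(M, k)%:R * 'C(N - M, n - k)%:R) / 'C(N, n)%:R.

(* The truncated differences are harmless: the parameters are used with
   M <= N, and k ranges over k <= minn M n. These masses add up to 1
   (Vandermonde), so they determine the law of X. *)
Definition is_hypergeometric (R : realType) (d : measure_display)
    (T : measurableType d) (P : probability T R) (X : {RV P >-> R})
    (M N n : nat) : Prop :=
  forall k : nat, (k <= minn M n)%N ->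
    P (X @^-1` [set k%:R]) = (hypergeometric_pmf R M N n k)%:E.

(* Main.v *)
Require Import Defs.
From HB Require Import structures.
From mathcomp Require Import all_boot all_order all_algebra.
From mathcomp Require Import all_classical all_reals all_analysis.
From mathcomp Require Import measurable_realfun ring lra.
Set Implicit Arguments.
Unset Strict Implicit.
Unset Printing Implicit Defensive.
Import Order.TTheory GRing.Theory Num.Theory.
Local Open Scope classical_set_scope.
Local Open Scope ring_scope.

(** It is enough to let one marked item among [N] be drawn once: for
    [M = n = 1] the hypergeometric law is the Bernoulli law with parameter
    [p = 1 / N], whose mean is [p] and whose variance is [p * (1 - p)].
    As [N] grows the standard deviation, of order [sqrt p], becomes much larger
    than the mean [p]. The atom [0] lies at distance [p] from the mean, hence
    less than [y] standard deviations away as soon as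
    [p < y ^+ 2 * (1 - p)]. From then on only the complement of that atom can
    contribute to the deviation event, and it has mass [1 / N], which is
    arbitrarily small.

    The hypothesis only gives the masses of the two atoms, so that the random
    variable is an indicator almost surely but not everywhere; its moments are
    obtained through [expectation_comp_bernoulli]. *)

Section bernoulli_masses.
Context {d : measure_display} {T : measurableType d} {R : realType}.
Context (P : probability T R) (X : {RV P >-> R}) (p : R).
Context (X0 : P (X @^-1` [set 0]) = (1 - p)%:E)
        (X1 : P (X @^-1` [set 1]) = p%:E).

Let measurable_atom (r : R) : measurable (X @^-1` [set r]).
Proof. by rewrite -[X @^-1` _]setTI; apply: measurable_funP. Qed.

(** The atoms [0] and [1] are disjoint and their masses add up to [1]. *)
Lemma ae_bernoulli : {ae P, forall t, X t = 0 \/ X t = 1}.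
Proof.
have m01 := measurableU _ _ (measurable_atom 0) (measurable_atom 1).
exists (~` (X @^-1` [set 0] `|` X @^-1` [set 1])); split => //.
- exact: measurableC.
- have disj : X @^-1` [set 0] `&` X @^-1` [set 1] = set0.
    by rewrite -preimage_setI setI1 memNset ?preimage_set0//= => /eqP;
      rewrite oner_eq0.
  rewrite probability_setC// (measureU P (measurable_atom 0) _ disj)//.
  rewrite [X in (_ - (X + _))%E]X0 [X in (_ - (_ + X))%E]X1.
  by rewrite -EFinD subrK subrr.
Qed.

(** Almost surely [f (X t)] is an affine function of the indicator of
    [X = 1]. *)
Lemma expectation_comp_bernoulli (f : R -> R) : measurable_fun setT f ->
  ('E_P[f \o X] = ((1 - p) * f 0 + p * f 1)%:E)%E.
Proof.
move=> mf; set A := X @^-1` [set 1]; have mA : measurable A := measurable_atom 1.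
have iA := integrable_indic P mA.
rewrite unlock (@ae_eq_integral _ _ _ P setT
  (fun t => (f 1 - f 0)%:E * (\1_A t)%:E + (f 0)%:E)%E)//.
- rewrite integralD//=; first last.
  + exact: finite_measure_integrable_cst.
  + exact: integrableZl.
  rewrite integralZl// integral_indic// setIT integral_cst//.
  rewrite [X in (_ + _ * X)%E]probability_setT mule1 [X in (_ * X + _)%E]X1.
  by rewrite -EFinM -EFinD; congr EFin; ring.
- apply/measurable_EFinP; exact: measurableT_comp.
- apply: emeasurable_funD => //; apply: measurable_funeM.
  exact/measurable_EFinP.
- apply: filterS ae_bernoulli => t Xt _ /=.
  rewrite indicE -EFinM -EFinD; congr EFin.
  case: Xt => Xt.
  + by rewrite memNset ?Xt ?mulr0 ?add0r//= /A/= Xt => /eqP;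
      rewrite eq_sym oner_eq0.
  + by rewrite mem_set ?Xt ?mulr1 ?subrK.
Qed.

Lemma expectation_bernoulli : ('E_P[X] = p%:E)%E.
Proof.
rewrite (_ : (X : T -> R) = idfun \o X)// expectation_comp_bernoulli//=; last first.
  exact: measurable_id.
by rewrite mulr0 mulr1 add0r.
Qed.

Lemma variance_bernoulli : ('V_P[X] = (p * (1 - p))%:E)%E.
Proof.
rewrite /variance unlock expectation_bernoulli/=.
rewrite (_ : (_ * _)%R = (fun x => (x - p) ^+ 2) \o X); last first.
  by apply/funext => t; rewrite /= expr2.
rewrite expectation_comp_bernoulli; first by congr EFin; ring.
by apply: measurable_funX; apply: measurable_funB.
Qed.

(** The atom [0] is at distance [p] from the mean, so the threshold excludes
    it. *)
Lemma bernoulli_deviation_le (c : R) : 0 <= p -> p < c ->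
  (P [set t | (c <= `|X t - p|)%R] <= p%:E)%E.
Proof.
move=> p0 pc; rewrite [leRHS](_ : _ = P (~` (X @^-1` [set 0]))); last first.
  by rewrite probability_setC// X0 -EFinB; congr EFin; ring.
apply: le_measure; rewrite ?inE; [|exact: measurableC|].
- rewrite -[X in measurable X]setTI; apply: measurable_fun_le => //.
  apply: measurableT_comp => //; exact: measurable_funB.
- move=> t /= ct Xt; move: ct; rewrite Xt sub0r normrN ger0_norm//.
  by rewrite leNgt pc.
Qed.

End bernoulli_masses.

Lemma mean_lt_deviation (R : realType) (p y : R) :
  0 < y -> 0 < p -> p < y ^+ 2 * (1 - p) -> p < y * Num.sqrt (p * (1 - p)).
Proof.
move=> y0 p0 py.
have p1 : 0 < 1 - p.
  by rewrite -(pmulr_rgt0 _ (exprn_gt0 2 y0)) (lt_trans p0).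
rewrite -(ltr_pXn2r (n := 2)) ?nnegrE ?(ltW p0) ?mulr_ge0 ?sqrtr_ge0 ?(ltW y0)//.
rewrite exprMn sqr_sqrtr ?mulr_ge0 ?(ltW p0) ?(ltW p1)//.
by rewrite mulrCA expr2 ltr_pM2l.
Qed.

Theorem proposition3p4 (R : realType)
    (d : nat -> nat -> nat -> measure_display)
    (T : forall M N n : nat, measurableType (d M N n))
    (P : forall M N n : nat, probability (T M N n) R)
    (X : forall M N n : nat, {RV (P M N n) >-> R})
    (hX : forall M N n : nat, (0 < M)%N -> (0 < N)%N -> (0 < n)%N ->
      (M <= N)%N -> (n <= N)%N -> is_hypergeometric (X M N n) M N n)
    (y : R) (hy : 0 < y) :
  ereal_inf [set p : \bar R | exists M N n : nat,
      [/\ (0 < M)%N, (0 < N)%N, (0 < n)%N, (M <= N)%N & (n <= N)%N] /\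
      p = P M N n [set t | y * Num.sqrt (fine ('V_(P M N n) [X M N n])) <=
                           `|X M N n t - fine ('E_(P M N n) [X M N n])%E| ]]
  = 0%E.
Proof.
apply/eqP; rewrite eq_le; apply/andP; split; last first.
  by apply: le_ereal_inf_tmp => _ [M [N [n [_ ->]]]]; exact: measure_ge0.
apply/lee_addgt0Pr => e e0; rewrite add0e.
(* [p < y ^+ 2 / (1 + y ^+ 2)] is [p < y ^+ 2 * (1 - p)] solved for [p] *)
have y1 : 0 < 1 + y ^+ 2 by rewrite addr_gt0// exprn_gt0.
have c0 : 0 < Num.min e (y ^+ 2 / (1 + y ^+ 2)).
  by rewrite lt_min e0 divr_gt0// exprn_gt0.
have [k _ /(_ k (leqnn k))/=] := near_infty_natSinv_lt (PosNum c0).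
rewrite lt_min ltr_pdivlMr// => /andP[pe py].
set p : R := k.+1%:R^-1 in pe py.
have p0 : 0 < p by rewrite invr_gt0.
have h := hX 1 k.+1 1 isT isT isT isT isT.
have X0 : P 1 k.+1 1 (X 1 k.+1 1 @^-1` [set 0]) = (1 - p)%:E.
  rewrite (h 0)// /hypergeometric_pmf bin0 mul1r subSS !subn0 !bin1; congr EFin.
  by rewrite -[in LHS](addrK 1 k%:R) natr1 mulrBl divff ?pnatr_eq0// mul1r.
have X1 : P 1 k.+1 1 (X 1 k.+1 1 @^-1` [set 1]) = p%:E.
  by rewrite (h 1)// /hypergeometric_pmf binn subnn bin0 bin1 !mul1r.
apply: ge_ereal_inf; eexists; first by exists 1, k.+1, 1; split.
rewrite (variance_bernoulli X0 X1) (expectation_bernoulli X0 X1).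
apply: le_trans (bernoulli_deviation_le X0 (ltW p0) _) _.
- by apply: mean_lt_deviation => //; move: py; rewrite mulrDr mulrBr !mulr1; lra.
- by rewrite lee_fin ltW.
Qed.
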